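(* Let $\mathbb{K}\in\{\mathbb{Q},\mathbb{R},\mathbb{C}\}$, let $d\ge 0$ and $a$ be integers, and put $r:=-(a+d)$ (the degree). Let $H(t)=\sum_{i=0}^\infty \gamma_i (1-t)^{i-d}$, $\gamma_i\in\mathbb{K}$, be a formal Laurent series around $t=1$ of pole order at most $d$, and stipulate $\gamma_i=0$ for $i<0$. Then $H$ satisfies the functional equation $$H(t^{-1})=(-1)^d t^{-a}H(t)$$ if and only if the following conditions hold. If $r$ is even, then for each $m\ge 1$: $$\sum_{i=0}^{m-1}(-1)^i\binom{m-1}{i}\gamma_{m-r+i}=0. \qquad (\mathrm{A})$$ If $r>0$ is odd, then for each $m\ge 1$: $$\sum_{i=0}^{m}(-1)^i\binom{2m+r-2}{m-i}\binom{m+i}{i}\gamma_{m+i-1}=0. \qquad (\mathrm{B})$$ If $r<0$ (of either parity), then for each $1\le m\le \lceil -r/2\rceil$: $$\sum_{i=0}^{m}\binom{m}{i}\binom{1-r}{m+i}^{-1}\gamma_{m+i-1}=0, \qquad (\mathrm{C})$$ and moreover, if $r<0$ is odd, then for each $m\ge1$: $$\sum_{i=0}^{m}(-1)^i\binom{m}{i}\frac{m+i}{m}\gamma_{m-r+i}=0. \qquad (\mathrm{D})$$ (Thus for $r<0$ even the conditions are (A) for all $m\ge1$ together with (C); for $r<0$ odd they are (C) together with (D).)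
   Context: The functional equation is understood as an identity of formal Laurent series in $u=1-t$: one substitutes $t=1-u$, $t^{-1}=\sum_{j\ge0}u^j$, $1-t^{-1}=-u/(1-u)$, so that $H(t^{-1})=\sum_i\gamma_i\left(-u/(1-u)\right)^{i-d}$, and $t^{-a}=(1-u)^{-a}$ is expanded as a power series in $u$. *)

(* Defs.v *)
(* Formal power series over a field K are coefficient
   functions nat -> K (coefficient of u^n, u = 1 - t). *)
From mathcomp Require Import all_boot all_order all_algebra.
Set Implicit Arguments. Unset Strict Implicit. Unset Printing Implicit Defensive.
Import Order.TTheory GRing.Theory Num.Theory.
Local Open Scope ring_scope.

Section FPS.
Variable K : numFieldType.

Definition fps_mul (f g : nat -> K) : nat -> K :=
  fun n => \sum_(j < n.+1) f j * g (n - j)%N.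
Definition fps_one : nat -> K := fun n => (n == 0%N)%:R.
Definition fps_pow (f : nat -> K) (k : nat) : nat -> K := iter k (fps_mul f) fps_one.
Definition fps_scale (c : K) (f : nat -> K) : nat -> K := fun n => c * f n.
Definition fps_u : nat -> K := fun n => (n == 1%N)%:R.
Definition fps_t : nat -> K := fun n => fps_one n - fps_u n.
Definition fps_tinv : nat -> K := fun _ => 1.
Definition fps_tpow (e : int) : nat -> K :=
  match e with Posz k => fps_pow fps_t k | Negz k => fps_pow fps_tinv k.+1 end.
(* 1 - t^{-1} = -u/(1-u) (a series without constant term) *)
Definition fps_one_minus_tinv : nat -> K := fun n => fps_one n - fps_tinv n.
(* substitution sum_i g_i w^i, for w without constant term (only i <= n
   contribute to the coefficient of u^n) *)
Definition fps_subst (g : nat -> K) (w : nat -> K) : nat -> K :=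
  fun n => \sum_(i < n.+1) g i * fps_pow w i n.

(* The functional equation H(t^{-1}) = (-1)^d t^{-a} H(t), where
   H(t) = sum_i gamma_i (1-t)^(i-d) = sum_i gamma_i u^(i-d), as an identity
   of formal Laurent series in u, multiplied through by u^d (an invertible
   element of the Laurent series ring):
     u^d H(t)       = sum_i gamma_i u^i,
     u^d H(t^{-1})  = u^d sum_i gamma_i (1-t^{-1})^(i-d)
                    = (-t)^d * sum_i gamma_i (1 - t^{-1})^i
   since u (1-t^{-1})^{-1} = -t.  *)
Definition functional_eq (d : nat) (a : int) (gamma : nat -> K) : Prop :=
  fps_mul (fps_pow (fps_scale (-1) fps_t) d) (fps_subst gamma fps_one_minus_tinv)
  =1 fps_scale ((-1) ^+ d) (fps_mul (fps_tpow (- a)) (fps_subst gamma fps_u)).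

Definition gamz (gamma : nat -> K) (z : int) : K :=
  match z with Posz n => gamma n | Negz _ => 0 end.

Definition condA (r : int) (gamma : nat -> K) (m : nat) : Prop :=
  \sum_(i < m) (-1) ^+ i * ('C(m.-1, i))%:R * gamz gamma (m%:Z - r + i%:Z) = 0.
(* (B), r = s > 0 *)
Definition condB (s : nat) (gamma : nat -> K) (m : nat) : Prop :=
  \sum_(i < m.+1) (-1) ^+ i * ('C(2 * m + s - 2, m - i))%:R * ('C(m + i, i))%:R
     * gamma (m + i - 1)%N = 0.
(* (C), r = -s < 0 *)
Definition condC (s : nat) (gamma : nat -> K) (m : nat) : Prop :=
  \sum_(i < m.+1) ('C(m, i))%:R * (('C(1 + s, m + i))%:R)^-1 * gamma (m + i - 1)%N = 0.
Definition condD (r : int) (gamma : nat -> K) (m : nat) : Prop :=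
  \sum_(i < m.+1) (-1) ^+ i * ('C(m, i))%:R * ((m + i)%:R / m%:R)
     * gamz gamma (m%:Z - r + i%:Z) = 0.

End FPS.

(* Main.v *)
Require Import Defs.
From mathcomp Require Import all_boot all_order all_algebra.
From mathcomp Require Import ring zify.
Import Order.TTheory GRing.Theory Num.Theory.
Local Open Scope ring_scope.

(** Put g = sum_i gamma_i u^i and w = -u/(1-u).  The functional equation says
    that g is fixed by T_r g = (1-u)^(-r) g(w), where T_r is an involution acting
    on u^n K[[u]] / u^(n+1) K[[u]] by (-1)^n.  Hence if a family of linear
    functionals vanishes on the fixed space of T_r and contains, for each odd n,
    one of the form c gamma_n + (lower coefficients) with c != 0, then the common
    kernel of the family is the fixed space.

    The vanishing is shown by moving r.  Multiplication by 1-u maps Fix(T_r) to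
    Fix(T_(r-2)) and turns (A) for m+1 into (A) for m; for m = 1 it says that
    gamma_(1-r) = 0, because T_r preserves the polynomials of degree <= -r.
    Multiplication by 2-u maps Fix(T_r) to Fix(T_(r-1)) and turns (D) into (A).
    Up to normalisation (B) and (C) are one family, with the generalised binomial
    coefficient of 2m+r-2; the map g |-> (2(1-u)g' - r g)/u from Fix(T_r) to
    Fix(T_(r+1)) takes its member of index m to the one of index m-1. *)

Set Implicit Arguments. Unset Strict Implicit. Unset Printing Implicit Defensive.

(** * Finite sums and the coefficients of (1-u)^e *)

Section Series.
Variable K : numFieldType.
Implicit Types (f g h gamma : nat -> K) (e r : K).

Lemma exchange_triangle (F : nat -> nat -> K) n :
  \sum_(j < n.+1) \sum_(i < (n - j).+1) F i j =
  \sum_(i < n.+1) \sum_(j < (n - i).+1) F i j.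
Proof.
have widen (G : nat -> K) (j : 'I_n.+1) :
    \sum_(i < (n - j).+1) G i = \sum_(i < n.+1 | (i + j < n.+1)%N) G i.
  have le : ((n - j).+1 <= n.+1)%N by lia.
  rewrite (big_ord_widen n.+1 G le); apply: eq_bigl => i.
  by have := ltn_ord j; lia.
rewrite (eq_bigr _ (fun (j : 'I_n.+1) _ => widen (F^~ j) j)).
rewrite [RHS](eq_bigr _ (fun (i : 'I_n.+1) _ => widen (F i) i)).
rewrite (exchange_big_dep xpredT) //=.
by apply: eq_bigr => i _; apply: eq_bigl => j; rewrite addnC.
Qed.

(** Summation by parts, used whenever a functional is applied to a series built from neighbouring
    coefficients. The condition [b m = 0] removes the boundary term. *)
Lemma sum_shift_merge (a b c G : nat -> K) m :
  c 0%N = b 0%N -> (forall i, (i < m)%N -> c i.+1 = a i + b i.+1) -> b m = 0 ->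
  \sum_(i < m) (a i * G i.+1 + b i * G i) = \sum_(i < m.+1) c i * G i.
Proof.
move=> c0 cS bm; rewrite big_split /= [RHS]big_ord_recl /= c0.
have -> : \sum_(i < m) b i * G i = \sum_(i < m.+1) b i * G i.
  by rewrite big_ord_recr /= bm mul0r addr0.
rewrite [in LHS]big_ord_recl /= addrCA -big_split /=; congr (_ + _).
by apply: eq_bigr => i _; rewrite /bump /= add1n cS // mulrDl.
Qed.

(* The coefficient of u^k in (1 - u)^e. *)
Definition tcoef e (k : nat) : K := (\prod_(j < k) (j%:R - e)) / k`!%:R.

Lemma natr_fact_neq0 k : k`!%:R != 0 :> K.
Proof. by rewrite pnatr_eq0 -lt0n fact_gt0. Qed.

Lemma tcoef0 e : tcoef e 0 = 1.
Proof. by rewrite /tcoef big_ord0 fact0 divr1. Qed.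

(** For f = (1-u)^e this is (1-u) f' = -e f read off at u^k; [tcoef_deriv] is f' = -e
    (1-u)^(e-1). *)
Lemma tcoefS e k : k.+1%:R * tcoef e k.+1 = (k%:R - e) * tcoef e k.
Proof.
rewrite /tcoef big_ord_recr /= factS natrM.
have k0 := natr_fact_neq0 k; have k1 : k.+1%:R != 0 :> K by rewrite pnatr_eq0.
by move: (k.+1%:R) (k`!%:R) k1 k0 => x y x0 y0; field; rewrite x0 y0.
Qed.

Lemma tcoef_deriv e k : k.+1%:R * tcoef e k.+1 = - e * tcoef (e - 1) k.
Proof.
rewrite /tcoef big_ord_recl /= factS natrM.
have k0 := natr_fact_neq0 k; have k1 : k.+1%:R != 0 :> K by rewrite pnatr_eq0.
under eq_bigr => i _ do rewrite /bump /= add1n.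
have -> : \prod_(i < k) (i.+1%:R - e) = \prod_(i < k) (i%:R - (e - 1)).
  by apply: eq_bigr => i _; rewrite -natr1; ring.
by move: (k.+1%:R) (k`!%:R) k1 k0 => x y x0 y0; field; rewrite x0 y0.
Qed.

Lemma tcoef_pascal e k : tcoef (e + 1) k.+1 = tcoef e k.+1 - tcoef e k.
Proof.
have k1 : k.+1%:R != 0 :> K by rewrite pnatr_eq0.
apply: (mulfI k1); rewrite tcoef_deriv addrK mulrBr tcoefS -natr1; ring.
Qed.

Lemma tcoef_zero k : tcoef 0 k = fps_one K k.
Proof.
case: k => [|k]; first by rewrite tcoef0.
have k1 : k.+1%:R != 0 :> K by rewrite pnatr_eq0.
by apply: (mulfI k1); rewrite tcoef_deriv oppr0 mul0r mulr0.
Qed.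

Lemma tcoef_nat_eq0 (l k : nat) : (l < k)%N -> tcoef l%:R k = 0.
Proof.
move=> lt; rewrite /tcoef (bigD1 (Ordinal lt)) //= subrr !mul0r //.
Qed.

Lemma tcoef_sum e n : \sum_(j < n.+1) tcoef e j = tcoef (e - 1) n.
Proof.
elim: n => [|n IH]; first by rewrite big_ord1 !tcoef0.
rewrite big_ord_recr /= IH.
by have := tcoef_pascal (e - 1) n; rewrite subrK => ->; rewrite addrC subrK.
Qed.

Lemma tcoef_bin (N k : nat) : tcoef N%:R k = (-1) ^+ k * 'C(N, k)%:R.
Proof.
elim: N k => [|N IH] [|k]; rewrite ?tcoef0 ?bin0 ?mulr1 //.
  by rewrite tcoef_zero bin0n mulr0.
by rewrite -natr1 tcoef_pascal !IH binS natrD exprS; ring.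
Qed.

Lemma tcoef_negbin (N k : nat) : tcoef (- N.+1%:R) k = 'C(N + k, k)%:R.
Proof.
elim: k => [|k IH]; first by rewrite tcoef0 bin0.
have k1 : k.+1%:R != 0 :> K by rewrite pnatr_eq0.
apply: (mulfI k1); rewrite tcoefS IH -natrM addnS -mul_bin_diag natrM opprK.
by rewrite -natrD; congr (_%:R * _); lia.
Qed.

(** Trinomial revision for generalised binomials. In [reflectionK] it isolates an alternating sum of
    ordinary binomials. *)
Lemma tcoef_trinomial r a k :
  tcoef (- r) a * tcoef (- (r + a%:R)) k = tcoef (- r) (a + k) * 'C(a + k, k)%:R.
Proof.
elim: k => [|k IH]; first by rewrite tcoef0 addn0 bin0.
have k1 : k.+1%:R != 0 :> K by rewrite pnatr_eq0.
apply: (mulfI k1); rewrite mulrCA tcoefS addnS.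
rewrite [RHS]mulrCA -natrM -mul_bin_diag natrM mulrA [_ * _.+1%:R]mulrC tcoefS.
rewrite mulrCA IH natrD; ring.
Qed.

(** Vandermonde by the Leibniz rule: writing n+1 = i + (n+1-i) in each term differentiates one
    factor at a time, and the induction hypothesis applies to both halves. *)
Lemma tcoefD a b n : fps_mul (tcoef a) (tcoef b) n = tcoef (a + b) n.
Proof.
rewrite /fps_mul; elim: n a b => [|n IH] a b; first by rewrite big_ord1 !tcoef0 mulr1.
have k1 : n.+1%:R != 0 :> K by rewrite pnatr_eq0.
apply: (mulfI k1); rewrite mulr_sumr.
pose G (i : nat) := i%:R * tcoef a i * tcoef b (n.+1 - i).
pose H (i : nat) := tcoef a i * ((n.+1 - i)%:R * tcoef b (n.+1 - i)).
rewrite (eq_bigr (fun i : 'I_n.+2 => G i + H i)); last first.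
  move=> i _; have le : (i <= n.+1)%N by rewrite -ltnS.
  by rewrite -{1}(subnKC le) natrD /G /H; ring.
rewrite big_split /= big_ord_recl /= {1}/G !mul0r add0r.
rewrite [X in _ + X]big_ord_recr /= {2}/H subnn mul0r mulr0 addr0.
rewrite (eq_bigr (fun i : 'I_n.+1 => - a * (tcoef (a - 1) i * tcoef b (n - i)))); last first.
  by move=> i _; rewrite /G /bump /= add1n tcoef_deriv subSS; ring.
rewrite [X in _ + X](eq_bigr (fun i : 'I_n.+1 => - b * (tcoef a i * tcoef (b - 1) (n - i)))); last first.
  move=> i _; have le : (i <= n)%N by rewrite -ltnS.
  by rewrite /H subSn // tcoef_deriv; ring.
rewrite -!mulr_sumr !IH tcoef_deriv addrAC addrA; ring.
Qed.

(** * Power series arithmetic, and the functional equation as a fixed-point equation *)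

Lemma fps_mul_eq f f' g g' : f =1 f' -> g =1 g' -> fps_mul f g =1 fps_mul f' g'.
Proof. by move=> ff gg n; apply: eq_bigr => i _; rewrite ff gg. Qed.

(** Only coefficients up to n matter, so associativity is borrowed from the polynomials truncated at
    degree n. *)
Lemma fps_mulA f g h : fps_mul f (fps_mul g h) =1 fps_mul (fps_mul f g) h.
Proof.
move=> n; pose P f : {poly K} := \poly_(i < n.+1) f i.
have PM f1 f2 k : (k <= n)%N -> fps_mul f1 f2 k = (P f1 * P f2)`_k.
  move=> le; rewrite coefM; apply: eq_bigr => i _; rewrite !coef_poly.
  by have := ltn_ord i; rewrite ltnS => lei; rewrite !ifT //; lia.
have -> : fps_mul f (fps_mul g h) n = (P f * (P g * P h))`_n.
  rewrite coefM; apply: eq_bigr => i _; rewrite PM ?leq_subr //.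
  by rewrite coef_poly ltn_ord.
rewrite mulrA coefM; apply: eq_bigr => i _.
have le : (i <= n)%N by rewrite -ltnS.
rewrite PM //.
by rewrite coef_poly ltnS leq_subr.
Qed.

Lemma fps_mul1 f : fps_mul (fps_one K) f =1 f.
Proof.
move=> n; rewrite /fps_mul big_ord_recl /= mul1r subn0 big1 ?addr0 // => i _.
by rewrite /fps_one /= mul0r.
Qed.

Lemma fps_mulZl c f g n : fps_mul (fps_scale c f) g n = c * fps_mul f g n.
Proof. by rewrite mulr_sumr; apply: eq_bigr => i _; rewrite mulrA. Qed.

Lemma fps_t_mulS f n : fps_mul (@fps_t K) f n.+1 = f n.+1 - f n.
Proof.
rewrite /fps_mul !big_ord_recl big1 /= => [|i _]; rewrite /fps_t /fps_one /fps_u /=.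
  by rewrite subSS !subn0 subr0 mul1r sub0r mulN1r addr0.
by rewrite subrr mul0r.
Qed.

Lemma fps_t_mul0 f : fps_mul (@fps_t K) f 0 = f 0%N.
Proof. by rewrite /fps_mul big_ord1 /fps_t /fps_one /fps_u /= subr0 mul1r. Qed.

Lemma fps_pow_t k : fps_pow (@fps_t K) k =1 tcoef k%:R.
Proof.
elim: k => [|k IH] n /=; first by rewrite tcoef_zero.
rewrite (fps_mul_eq (frefl _) IH); case: n => [|n].
  by rewrite fps_t_mul0 !tcoef0.
by rewrite fps_t_mulS -natr1 tcoef_pascal.
Qed.

Lemma fps_pow_tinv k : fps_pow (@fps_tinv K) k =1 tcoef (- k%:R).
Proof.
elim: k => [|k IH] n /=; first by rewrite oppr0 tcoef_zero.
rewrite (fps_mul_eq (frefl _) IH) /fps_mul.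
rewrite (reindex_inj rev_ord_inj) /= (eq_bigr (fun i : 'I_n.+1 => tcoef (- k%:R) i)).
  by rewrite tcoef_sum -natr1 opprD.
by move=> i _; rewrite /fps_tinv mul1r; congr tcoef; have := ltn_ord i; lia.
Qed.

Lemma fps_tpowE (e : int) : fps_tpow K e =1 tcoef e%:~R.
Proof.
case: e => k n; first by rewrite /= fps_pow_t pmulrn.
by rewrite -[LHS]/(fps_pow (@fps_tinv K) k.+1 n) fps_pow_tinv NegzE mulrNz -pmulrn.
Qed.

Lemma fps_pow_Nt d : fps_pow (fps_scale (-1) (@fps_t K)) d
  =1 fps_scale ((-1) ^+ d) (tcoef d%:R).
Proof.
elim: d => [|d IH] n; first by rewrite /= /fps_scale mul1r tcoef_zero.
rewrite /= fps_mulZl (fps_mul_eq (frefl _) IH).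
have -> : fps_mul (@fps_t K) (fps_scale ((-1) ^+ d) (tcoef d%:R)) n
    = (-1) ^+ d * fps_mul (@fps_t K) (tcoef d%:R) n.
  by rewrite /fps_mul mulr_sumr; apply: eq_bigr => i _; rewrite /fps_scale mulrCA.
rewrite /fps_scale exprS mulrA; congr (_ * _).
by rewrite -fps_pow_t /= (fps_mul_eq (frefl _) (fps_pow_t d)).
Qed.

Lemma fps_pow_u i n : fps_pow (@fps_u K) i n = (n == i)%:R.
Proof.
elim: i n => [|i IH] n //=; rewrite (fps_mul_eq (frefl _) IH).
case: n => [|n]; first by rewrite /fps_mul big_ord1 /fps_u /= mul0r.
rewrite /fps_mul !big_ord_recl big1 /= => [|j _]; rewrite /fps_u /=.
  by rewrite subSS !subn0 mul0r mul1r add0r addr0 eqSS.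
by rewrite mul0r.
Qed.

Lemma fps_subst_u gamma : fps_subst gamma (@fps_u K) =1 gamma.
Proof.
move=> n; rewrite /fps_subst big_ord_recr /= fps_pow_u eqxx mulr1 big1 ?add0r //.
by move=> i _; rewrite fps_pow_u gtn_eqF ?ltn_ord // mulr0.
Qed.

Lemma fps_pow_one_minus_tinv_lt i n : (n < i)%N ->
  fps_pow (@fps_one_minus_tinv K) i n = 0.
Proof.
elim: i n => [//|i IH] n lt; rewrite /= /fps_mul big_ord_recl big1 /= => [|j _].
  by rewrite /fps_one_minus_tinv /fps_one /fps_tinv /= subrr mul0r addr0.
by rewrite IH ?mulr0 //; rewrite /bump /=; have := ltn_ord j; lia.
Qed.

(** This is w^i = (-u)^i (1-u)^(-i). Multiplying by w = -(u + u^2 + ...) takes negated partial sums,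
    which [tcoef_sum] evaluates. *)
Lemma fps_pow_one_minus_tinv i k :
  fps_pow (@fps_one_minus_tinv K) i (i + k) = (-1) ^+ i * tcoef (- i%:R) k.
Proof.
elim: i k => [|i IH] k; first by rewrite /= mul1r oppr0 tcoef_zero.
rewrite /= /fps_mul big_ord_recl /=.
rewrite {1}/fps_one_minus_tinv /fps_one /fps_tinv /= subrr mul0r add0r.
pose F (j : nat) := - fps_pow (@fps_one_minus_tinv K) i j.
rewrite (eq_bigr (fun j : 'I_(i + k).+1 => F (i + k - j)%N)); last first.
  move=> j _; rewrite /F /fps_one_minus_tinv /fps_one /fps_tinv /= sub0r mulN1r.
  by rewrite /bump /= add1n subSS.
rewrite (reindex_inj rev_ord_inj) /=.
rewrite (eq_bigr (fun j : 'I_(i + k).+1 => F j)); last first.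
  by move=> j _; congr F; have := ltn_ord j; lia.
rewrite -(big_mkord xpredT F) (big_cat_nat (n := i)) //=; last by lia.
rewrite big_nat big1 => [|j /andP[_ lt]]; last first.
  by rewrite /F fps_pow_one_minus_tinv_lt ?oppr0.
rewrite add0r -{1}[i]add0n big_addn -addnS addKn big_mkord.
rewrite (eq_bigr (fun j : 'I_k.+1 => (-1) ^+ i.+1 * tcoef (- i%:R) j)); last first.
  by move=> j _; rewrite /F addnC IH exprS; ring.
by rewrite -mulr_sumr tcoef_sum -natr1 opprD.
Qed.

(* The coefficients of (1 - u)^(-r) g(-u/(1 - u)), for g = sum_i gamma_i u^i. *)
Definition reflection r gamma (n : nat) : K :=
  \sum_(i < n.+1) (-1) ^+ i * tcoef (- (r + i%:R)) (n - i) * gamma i.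

Lemma reflection_mul r gamma :
  fps_mul (tcoef (- r)) (fps_subst gamma (@fps_one_minus_tinv K)) =1 reflection r gamma.
Proof.
move=> n; rewrite /fps_mul /reflection.
pose F (i j : nat) := (-1) ^+ i * gamma i * (tcoef (- r) j * tcoef (- i%:R) (n - i - j)).
rewrite (eq_bigr (fun j : 'I_n.+1 => \sum_(i < (n - j).+1) F i j)); last first.
  move=> j _; rewrite /fps_subst mulr_sumr; apply: eq_bigr => i _.
  have le : (i <= n - j)%N by rewrite -ltnS.
  have := fps_pow_one_minus_tinv i (n - j - i); rewrite (subnKC le) => ->.
  by rewrite /F subnAC; ring.
rewrite exchange_triangle; apply: eq_bigr => i _.
rewrite /F -mulr_sumr -[\sum_(j < _) _]/(fps_mul (tcoef (- r)) (tcoef (- i%:R)) (n - i)).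
by rewrite tcoefD opprD mulrAC.
Qed.

(** After the sign (-1)^d cancels, the equation reads (1-u)^d g(w) = (1-u)^(-a) g; multiplying by
    the unit (1-u)^a gives exponent a+d = -r on the left. *)
Lemma functional_eq_reflection (d : nat) (a : int) gamma :
  functional_eq d a gamma <-> reflection (- (a + d%:Z))%:~R gamma =1 gamma.
Proof.
set S := fps_subst gamma (@fps_one_minus_tinv K).
have sgn0 : (-1) ^+ d != 0 :> K by rewrite signr_eq0.
have -> : functional_eq d a gamma <->
    fps_mul (tcoef d%:R) S =1 fps_mul (tcoef (- a%:~R)) gamma.
  split=> E n.
    apply: (mulfI sgn0); have := E n.
    rewrite (fps_mul_eq (fps_pow_Nt d) (frefl _)) fps_mulZl => ->.
    rewrite /fps_scale; congr (_ * _); apply: fps_mul_eq (fps_subst_u gamma) n => k.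
    by rewrite fps_tpowE mulrNz.
  rewrite (fps_mul_eq (fps_pow_Nt d) (frefl _)) fps_mulZl E.
  rewrite /fps_scale; congr (_ * _); apply: fps_mul_eq => k.
    by rewrite fps_tpowE mulrNz.
  by rewrite fps_subst_u.
have refl : reflection (- (a + d%:Z))%:~R gamma =1
    fps_mul (tcoef a%:~R) (fps_mul (tcoef d%:R) S).
  move=> n; rewrite fps_mulA (fps_mul_eq (tcoefD _ _) (frefl _)) -reflection_mul.
  by rewrite mulrNz opprK intrD -pmulrn.
split=> E n.
  rewrite refl (fps_mul_eq (frefl _) E) fps_mulA (fps_mul_eq (tcoefD _ _) (frefl _)).
  by rewrite subrr (fps_mul_eq tcoef_zero (frefl _)) fps_mul1.
rewrite -(fps_mul_eq (frefl _) E) (fps_mul_eq (frefl _) refl) fps_mulA.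
by rewrite (fps_mul_eq (tcoefD _ _) (frefl _)) addNr (fps_mul_eq tcoef_zero (frefl _)) fps_mul1.
Qed.

End Series.

(** * The involution T_r and maps between its fixed spaces *)

Section Reflection.
Variable K : numFieldType.
Implicit Types (f g gamma : nat -> K) (r : K).

Lemma eq_reflection r f g : f =1 g -> reflection r f =1 reflection r g.
Proof. by move=> fg n; apply: eq_bigr => i _; rewrite fg. Qed.

Lemma reflectionD r f g n :
  reflection r (fun k => f k + g k) n = reflection r f n + reflection r g n.
Proof. by rewrite -big_split; apply: eq_bigr => i _; rewrite mulrDr. Qed.

Lemma reflectionB r f g n :
  reflection r (fun k => f k - g k) n = reflection r f n - reflection r g n.
Proof. by rewrite -sumrB; apply: eq_bigr => i _; rewrite mulrBr. Qed.

Lemma sum_signed_bin l : \sum_(k < l.+1) (-1) ^+ k * 'C(l, k)%:R = (l == 0%N)%:R :> K.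
Proof.
have := exprBn (1 : K) 1 l; rewrite subrr expr0n => ->.
by apply: eq_bigr => k _; rewrite !expr1n !mulr1 mulr_natr.
Qed.

(** The substitution w is an involution sending 1-u to its inverse, so the prefactors cancel. In
    coefficients, the alternating row sum of binomials kills every term except j = n. *)
Lemma reflectionK r gamma : reflection r (reflection r gamma) =1 gamma.
Proof.
move=> n; rewrite /reflection (reindex_inj rev_ord_inj) /=.
pose F (j k : nat) := ((-1) ^+ n * (-1) ^+ j * tcoef (- (r + j%:R)) (n - j) * gamma j)
   * ((-1) ^+ k * 'C(n - j, k)%:R).
rewrite (eq_bigr (fun k : 'I_n.+1 => \sum_(j < (n - k).+1) F j k)); last first.
  move=> k _; have lek : (k <= n)%N by rewrite -ltnS.
  rewrite subSS mulr_sumr subKn //; apply: eq_bigr => j _.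
  have lej : (j <= n - k)%N by rewrite -ltnS.
  have := tcoef_trinomial (r + j%:R) (n - k - j) k.
  have -> : (n - k - j + k = n - j)%N by lia.
  have -> : r + j%:R + (n - k - j)%:R = r + (n - k)%:R.
    by rewrite -addrA -natrD subnKC.
  move=> E; rewrite /F.
  have -> : (-1) ^+ (n - k) = (-1) ^+ n * (-1) ^+ k :> K.
    by rewrite -signr_odd oddB // signr_addb !signr_odd.
  transitivity ((-1) ^+ n * (-1) ^+ k * (-1) ^+ j * gamma j *
    (tcoef (- (r + j%:R)) (n - k - j) * tcoef (- (r + (n - k)%:R)) k)); first by ring.
  by rewrite E; ring.
rewrite exchange_triangle big_ord_recr /= big1 => [|j _]; last first.
  by rewrite /F -mulr_sumr sum_signed_bin subn_eq0 leqNgt ltn_ord mulr0.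
rewrite /F -mulr_sumr sum_signed_bin subnn eqxx tcoef0 add0r !mulr1.
by rewrite -expr2 sqrr_sign mul1r.
Qed.

(* The coefficients of (1 - u) g. *)
Definition mul1u gamma (n : nat) : K := gamma n - gamz gamma (n%:Z - 1).

Lemma mul1uS gamma n : mul1u gamma n.+1 = gamma n.+1 - gamma n.
Proof. by rewrite /mul1u (_ : n.+1%:Z - 1 = n%:Z) //; lia. Qed.

Lemma mul1u0 gamma : mul1u gamma 0 = gamma 0%N.
Proof. by rewrite /mul1u /= subr0. Qed.

Lemma gamz_mul1u gamma (z : int) :
  gamz (mul1u gamma) z = gamz gamma z - gamz gamma (z - 1).
Proof.
by case: z => n //=; rewrite subrr.
Qed.

Lemma mul1u_reflection r gamma : mul1u (reflection r gamma) =1 reflection (r - 1) gamma.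
Proof.
case=> [|n]; first by rewrite mul1u0 /reflection !big_ord1 !tcoef0.
rewrite mul1uS /reflection [X in X - _]big_ord_recr [RHS]big_ord_recr /=.
rewrite !subnn !tcoef0 addrAC -sumrB; congr (_ + _); apply: eq_bigr => i _.
have le : (i <= n)%N by rewrite -ltnS.
rewrite subSn // -mulrBl -mulrBr -tcoef_pascal.
by congr (_ * tcoef _ _ * _); ring.
Qed.

(** Substituting w turns the factor 1-u into (1-u)^(-1). The proof conjugates [mul1u_reflection] by
    the involution. *)
Lemma reflection_mul1u r gamma : reflection r (mul1u gamma) =1 reflection (r + 1) gamma.
Proof.
move=> n; rewrite -[RHS](reflectionK r); apply: eq_reflection => k.
have := mul1u_reflection (r + 1) (reflection (r + 1) gamma) k.
rewrite addrK => <-; rewrite /mul1u reflectionK; congr (_ - _).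
by case: (k%:Z - 1) => //= j; rewrite reflectionK.
Qed.

Lemma fixed_mul1u r gamma : reflection r gamma =1 gamma ->
  reflection (r - 2) (mul1u gamma) =1 mul1u gamma.
Proof.
move=> fix_g n; rewrite reflection_mul1u.
have -> : r - 2 + 1 = r - 1 by ring.
rewrite -mul1u_reflection /mul1u fix_g; congr (_ - _).
by case: (n%:Z - 1) => //= j; rewrite fix_g.
Qed.

(** Write 2-u = 1 + (1-u): on a fixed g, T_(r-1) interchanges g and (1-u) g, so their sum is
    fixed. *)
Lemma fixed_mul2u r gamma : reflection r gamma =1 gamma ->
  reflection (r - 1) (fun n => gamma n + mul1u gamma n) =1
  (fun n => gamma n + mul1u gamma n).
Proof.
move=> fix_g n; rewrite reflectionD reflection_mul1u subrK fix_g addrC; congr (_ + _).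
rewrite -mul1u_reflection /mul1u fix_g; congr (_ - _).
by case: (n%:Z - 1) => //= j; rewrite fix_g.
Qed.

(* The coefficients of 2 (1 - u) g' - r g. *)
Definition hder r gamma (n : nat) : K :=
  2 * n.+1%:R * gamma n.+1 - (2 * n%:R + r) * gamma n.

(** Chain rule: w' = -(1-u)^(-2) and 1-w = (1-u)^(-1) give the minus sign, and the term -r g absorbs
    the derivative of the prefactor (1-u)^(-r). The proof compares the coefficients of each
    [gamma i]. *)
Lemma reflection_hder r gamma n :
  reflection r (hder r gamma) n = - hder r (reflection r gamma) n.
Proof.
rewrite {1}/reflection /hder.
pose x (i : nat) := (-1) ^+ i * tcoef (- (r + i%:R)) (n - i).
pose a (i : nat) := x i * (2 * i.+1%:R).
(* The cut-off is needed because [n - i] truncates to 0 at i = n+1, where the coefficient should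
   vanish. *)
pose b (i : nat) := if (i <= n)%N then - (x i * (2 * i%:R + r)) else 0.
pose c (i : nat) := - (2 * n.+1%:R * ((-1) ^+ i * tcoef (- (r + i%:R)) (n.+1 - i)))
  + (if (i <= n)%N then (2 * n%:R + r) * x i else 0).
rewrite (eq_bigr (fun i : 'I_n.+1 => a i * gamma i.+1 + b i * gamma i)); last first.
  by move=> i _; rewrite /a /b -ltnS ltn_ord /x; ring.
rewrite (@sum_shift_merge _ a b c).
- rewrite /reflection !mulr_sumr opprB.
  rewrite (eq_bigr (fun i : 'I_n.+2 =>
    - (2 * n.+1%:R * ((-1) ^+ i * tcoef (- (r + i%:R)) (n.+1 - i) * gamma i)) +
    (if (i <= n)%N then (2 * n%:R + r) * x i * gamma i else 0))); last first.
    by move=> i _; rewrite /c; case: ifP => _; ring.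
  rewrite big_split /= addrC sumrN; congr (_ - _).
  rewrite big_ord_recr /= ltnn addr0; apply: eq_bigr => i _.
  by rewrite -ltnS ltn_ord /x; ring.
- rewrite /c /b /x /= !subn0 addr0 expr0.
  have := tcoefS (- r) n => E.
  transitivity (- 2 * (n.+1%:R * tcoef (- r) n.+1) + (2 * n%:R + r) * tcoef (- r) n).
    by ring.
  by rewrite E; ring.
- move=> i; rewrite ltnS leq_eqVlt => /orP[/eqP -> | lt].
    by rewrite /c /b /a /x ltnn !subnn !tcoef0 exprS; ring.
  rewrite /c /b /a /x lt subSS.
  have -> : (n - i = (n - i.+1).+1)%N by lia.
  have -> : n = (n - i.+1 + i.+1)%N by lia.
  rewrite addnK; move: (n - i.+1)%N => k.
  have := tcoefS (- (r + i.+1%:R)) k.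
  have := tcoef_pascal (- (r + i.+1%:R)) k.
  have -> : - (r + i.+1%:R) + 1 = - (r + i%:R) by rewrite -natr1; ring.
  move=> -> E.
  rewrite -addSn natrD exprS mulrCA.
  transitivity ((-1) ^+ i * (2 * (k.+1%:R * tcoef (- (r + i.+1%:R)) k.+1)
     + 2 * i.+1%:R * tcoef (- (r + i.+1%:R)) k.+1
     - (2 * (k + i.+1)%:R + r) * tcoef (- (r + i.+1%:R)) k)); first by rewrite natrD; ring.
  by rewrite E natrD -natr1; ring.
- by rewrite /b ltnn.
Qed.

(** Division by u: since 1/w = -(1-u)/u, replacing f by f/u costs a sign and one power of 1-u. *)
Lemma reflection_shift r f n : f 0%N = 0 ->
  reflection (r + 1) (fun k => f k.+1) n = - reflection r f n.+1.
Proof.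
move=> f0; rewrite /reflection [in RHS]big_ord_recl /= f0 mulr0 add0r -sumrN.
apply: eq_bigr => i _; rewrite /bump /= add1n subSS exprS.
have -> : r + 1 + i%:R = r + i.+1%:R by rewrite -natr1; ring.
ring.
Qed.

Lemma hder_fixed0 r gamma : reflection r gamma =1 gamma -> hder r gamma 0 = 0.
Proof.
move=> fix_g; have := reflection_hder r gamma 0.
rewrite {1}/reflection big_ord1 tcoef0 !mul1r {2}/hder !fix_g -/(hder r gamma 0).
by move/eqP; rewrite -addr_eq0 -mulr2n mulrn_eq0 /= => /eqP.
Qed.

(** The sign from anticommutation cancels the sign from division by u; [hder_fixed0] makes the
    division possible. *)
Lemma fixed_hder r gamma : reflection r gamma =1 gamma ->
  reflection (r + 1) (fun n => hder r gamma n.+1) =1 (fun n => hder r gamma n.+1).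
Proof.
move=> fix_g n; rewrite (reflection_shift r n (hder_fixed0 fix_g)) reflection_hder opprK.
by rewrite /hder !fix_g.
Qed.

(** * A triangular criterion for being fixed *)

Lemma gamzB f g (z : int) : gamz (fun k => f k - g k) z = gamz f z - gamz g z.
Proof. by case: z => n //=; rewrite subr0. Qed.

Lemma gamzD f g (z : int) : gamz (fun k => f k + g k) z = gamz f z + gamz g z.
Proof. by case: z => n //=; rewrite addr0. Qed.

(** The defect [dl] = T_r g - g lies in the (-1)-eigenspace and equals a fixed series minus 2g, so
    every functional kills it. Its coefficients vanish by strong induction: odd ones by the
    functional with top index n, even ones by the eigenvalue. *)
Lemma fixed_of_functionals r gamma :
  (forall n, odd n -> exists m (c : nat -> K) (x : nat -> int),
    [/\ c m != 0, x m = n%:Z, forall i, (i < m)%N -> x i < n%:Z,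
        forall f, reflection r f =1 f -> \sum_(i < m.+1) c i * gamz f (x i) = 0
      & \sum_(i < m.+1) c i * gamz gamma (x i) = 0]) ->
  reflection r gamma =1 gamma.
Proof.
move=> Ls; pose s k := reflection r gamma k + gamma k.
have fix_s : reflection r s =1 s.
  by move=> k; rewrite /s reflectionD reflectionK addrC.
pose dl k := s k - gamma k - gamma k.
have dlE k : dl k = reflection r gamma k - gamma k by rewrite /dl /s addrK.
have refl_dl k : reflection r dl k = - dl k.
  by rewrite (eq_reflection r dlE) reflectionB reflectionK dlE opprB.
suff dl0 n : dl n = 0.
  by move=> n; apply/eqP; rewrite -subr_eq0 -dlE dl0.
have [m] := ubnP n; elim: m n => [//|m IH] n lt_nm.
have low k : (k < n)%N -> dl k = 0 by move=> lt; apply: IH; lia.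
have [odd_n|even_n] := boolP (odd n).
  have [k [c [x [ck xk xlt Lfix Lg]]]] := Ls n odd_n.
  have : \sum_(i < k.+1) c i * gamz dl (x i) = 0.
    transitivity (\sum_(i < k.+1) c i * gamz s (x i)
      - \sum_(i < k.+1) c i * gamz gamma (x i)
      - \sum_(i < k.+1) c i * gamz gamma (x i)); last first.
      by rewrite Lfix // Lg !subr0.
    by rewrite -!sumrB; apply: eq_bigr => i _; rewrite !gamzB !mulrBr.
  rewrite big_ord_recr /= big1 => [|i _]; last first.
    have := xlt i (ltn_ord i); case: (x i) => j /= lt; last by rewrite mulr0.
    by rewrite low ?mulr0.
  by rewrite add0r xk /= => /eqP; rewrite mulf_eq0 (negbTE ck) /= => /eqP.
(* For even n the leading coefficient of T_r [dl] is [dl n] itself, so [dl n] equals its own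
   negative. *)
have := refl_dl n; rewrite /reflection big_ord_recr /= big1 => [|i _]; last first.
  by rewrite low ?mulr0.
rewrite subnn tcoef0 add0r mulr1 -signr_odd (negbTE even_n) mul1r.
by move/eqP; rewrite -addr_eq0 -mulr2n mulrn_eq0 /= => /eqP.
Qed.

End Reflection.

(** * The four conditions hold on the fixed space *)

Section Conditions.
Variable K : numFieldType.
Implicit Types (gamma : nat -> K).

Lemma fixed_even_vanish (r : int) gamma : ~~ odd `|r|%N ->
  reflection r%:~R gamma =1 gamma -> gamz gamma (1 - r) = 0.
Proof.
(* A negative index 1-r is settled by the convention that [gamz] is 0 there. *)
move=> even_r fix_g; case E : (1 - r) => [n|] //=.
have Er : r = 1 - n%:Z by lia.
have odd_n : odd n by lia.
have := fix_g n; rewrite /reflection big_ord_recr /= big1 => [|i _]; last first.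
  have lt := ltn_ord i.
  (* The exponent is the natural number n-i-1, so (1-u)^(n-i-1) is a polynomial with no term
     u^(n-i), and only the sign (-1)^n of the top term survives. *)
  have -> : - (r%:~R + i%:R) = (n - i).-1%:R :> K.
    by rewrite !pmulrn -intrD -mulrNz; congr (_%:~R); lia.
  by rewrite tcoef_nat_eq0 ?mulr0 ?mul0r //; lia.
rewrite subnn tcoef0 add0r mulr1 -signr_odd odd_n expr1 mulN1r => /eqP.
by rewrite eq_sym -addr_eq0 -mulr2n mulrn_eq0 /= => /eqP.
Qed.

Lemma fixed_condA (r : int) gamma m : ~~ odd `|r|%N ->
  reflection r%:~R gamma =1 gamma -> (0 < m)%N -> condA r gamma m.
Proof.
case: m => // m even_r fix_g _; rewrite /condA /=.
elim: m r gamma even_r fix_g => [|m IH] r gamma even_r fix_g.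
  by rewrite big_ord1 bin0 !mul1r addr0 fixed_even_vanish.
have even_r2 : ~~ odd `|r - 2|%N by lia.
have fix1 : reflection (r - 2)%:~R (mul1u gamma) =1 mul1u gamma.
  by rewrite intrB; apply: fixed_mul1u.
have := IH _ _ even_r2 fix1.
pose G (i : nat) := gamz gamma (m.+2%:Z - r + i%:Z).
pose a (i : nat) : K := (-1) ^+ i * 'C(m, i)%:R.
rewrite (eq_bigr (fun i : 'I_m.+1 => a i * G i.+1 + - a i * G i)); last first.
  move=> i _; rewrite gamz_mul1u mulrBr mulNr /G.
  by congr (_ * gamz _ _ - _ * gamz _ _); lia.
rewrite (@sum_shift_merge _ a (fun i => - a i)
           (fun i => - ((-1) ^+ i * 'C(m.+1, i)%:R)) G).
- move/(congr1 -%R); rewrite oppr0 -sumrN; apply: etrans.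
  by apply: eq_bigr => i _; rewrite mulNr opprK.
- by rewrite /a !bin0.
- by move=> i _; rewrite /a binS natrD exprS; ring.
- by rewrite /a bin_small // mulr0 oppr0.
Qed.

Lemma fixed_condD (r : int) gamma m : odd `|r|%N ->
  reflection r%:~R gamma =1 gamma -> (0 < m)%N -> condD r gamma m.
Proof.
case: m => // m odd_r fix_g _.
have even_r1 : ~~ odd `|r - 1|%N by lia.
have fix1 : reflection (r - 1)%:~R (fun n => gamma n + mul1u gamma n)
    =1 (fun n => gamma n + mul1u gamma n).
  by rewrite intrB; apply: fixed_mul2u.
have := fixed_condA even_r1 fix1 (ltn0Sn m); rewrite /condA /condD /=.
pose G (i : nat) := gamz gamma (m.+1%:Z - r + i%:Z).
pose a (i : nat) : K := (-1) ^+ i * 'C(m, i)%:R.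
rewrite (eq_bigr (fun i : 'I_m.+1 => 2 * a i * G i.+1 + - a i * G i)); last first.
  move=> i _; rewrite gamzD gamz_mul1u /G.
  have -> : m.+1%:Z - (r - 1) + i%:Z - 1 = m.+1%:Z - r + i%:Z by lia.
  have -> : m.+1%:Z - (r - 1) + i%:Z = m.+1%:Z - r + i.+1%:Z by lia.
  by rewrite /a; ring.
have m0 : m.+1%:R != 0 :> K by rewrite pnatr_eq0.
rewrite (@sum_shift_merge _ (fun i => 2 * a i) (fun i => - a i)
  (fun i => - ((-1) ^+ i * 'C(m.+1, i)%:R * ((m.+1 + i)%:R / m.+1%:R))) G).
- move/(congr1 -%R); rewrite oppr0 -sumrN; apply: etrans.
  by apply: eq_bigr => i _; rewrite mulNr opprK.
- by rewrite /a !bin0 addn0 divff // mulr1.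
(* Up to sign the merged coefficient is 2 C(m,i) + C(m,i+1) = C(m+1,i+1) + C(m,i), and C(m,i) =
   C(m+1,i+1) (i+1)/(m+1) by absorption. *)
- move=> i _; rewrite /a.
  have E : m.+1%:R * 'C(m, i)%:R = i.+1%:R * 'C(m.+1, i.+1)%:R :> K.
    by rewrite -!natrM mul_bin_diag.
  have P : 'C(m.+1, i.+1)%:R = 'C(m, i.+1)%:R + 'C(m, i)%:R :> K by rewrite binS natrD.
  have -> : 'C(m, i.+1)%:R = 'C(m.+1, i.+1)%:R - 'C(m, i)%:R :> K by rewrite P addrK.
  have -> : 'C(m, i)%:R = i.+1%:R * 'C(m.+1, i.+1)%:R / m.+1%:R :> K.
    by rewrite -E mulrAC divff // mul1r.
  rewrite natrD exprS; move: (m.+1%:R) m0 => x x0; field; exact: x0.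
- by rewrite /a bin_small // mulr0 oppr0.
Qed.

(* The left-hand sides of (B) and (C) at m.+1 are constant multiples of this sum,
   for r = s and r = - s respectively. *)
Definition binsum (r : K) m gamma : K :=
  \sum_(i < m.+2) tcoef (2 * m%:R + r) (m.+1 - i) * 'C(m.+1 + i, i)%:R * gamma (m + i)%N.

(** Going from (r, m+1) to (r+1, m) lowers the upper parameter N by one, so Pascal's rule and the
    recurrence [tcoefS] match the coefficients. *)
Lemma binsum_hder r m gamma :
  binsum (r + 1) m (fun n => hder r gamma n.+1) = m.+2%:R * binsum r m.+1 gamma.
Proof.
rewrite /binsum; set N := 2 * m.+1%:R + r.
have -> : 2 * m%:R + (r + 1) = N - 1 by rewrite /N -natr1; ring.
pose t (i : nat) := tcoef (N - 1) (m.+1 - i) * 'C(m.+1 + i, i)%:R.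
pose a (i : nat) := t i * (2 * (m.+2 + i)%:R).
pose b (i : nat) := if (i < m.+2)%N then - (t i * (N + 2 * i%:R)) else 0.
pose c (i : nat) := m.+2%:R * (tcoef N (m.+2 - i) * 'C(m.+2 + i, i)%:R).
pose G (i : nat) := gamma (m.+1 + i)%N.
rewrite (eq_bigr (fun i : 'I_m.+2 => a i * G i.+1 + b i * G i)); last first.
  move=> i _; rewrite /a /b ltn_ord -/(t i); move: (t i) => ti.
  rewrite /G /hder /N [(m.+1 + i.+1)%N]addnS !addSn -!natr1 !natrD; ring.
rewrite (@sum_shift_merge _ a b c G).
- by rewrite mulr_sumr; apply: eq_bigr => i _; rewrite [RHS]mulrA.
- rewrite /c /b /t /= !subn0 !bin0 !mulr1 tcoef_deriv; ring.
- move=> i lt_i.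
  have E1 : (m.+2 + i)%:R * 'C(m.+1 + i, i)%:R = i.+1%:R * 'C(m.+2 + i, i.+1)%:R :> K.
    by rewrite -!natrM !addSn mul_bin_diag.
  have E2 : m.+2%:R * 'C(m.+2 + i.+1, i.+1)%:R
      = (m.+2 + i.+1)%:R * 'C(m.+2 + i, i.+1)%:R :> K.
    by rewrite -!natrM [(m.+2 + i.+1)%N]addnS mul_bin_down; congr (_ * _)%:R; lia.
  have -> : c i.+1 = (m.+2 + i.+1)%:R * 'C(m.+2 + i, i.+1)%:R * tcoef N (m.+2 - i.+1).
    by rewrite /c mulrCA E2; ring.
  have -> : a i = 2 * tcoef (N - 1) (m.+1 - i) * (i.+1%:R * 'C(m.+2 + i, i.+1)%:R).
    by rewrite -E1 /a /t; ring.
  rewrite subSS /b /t ltnS; have [lt|ge] := ltnP; last first.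
    have -> : i = m.+1 by lia.
    by rewrite subnn !tcoef0 natrD; ring.
  have -> : (m.+1 + i.+1 = m.+2 + i)%N by lia.
  rewrite subSS; set Z := 'C(_, _)%:R.
  have -> : (m.+1 - i = (m - i).+1)%N by lia.
  have := tcoef_pascal (N - 1) (m - i); rewrite subrK => ->.
  have := tcoefS (N - 1) (m - i).
  have -> : (m - i).+1%:R = m.+1%:R - i%:R :> K by rewrite -natrB //; congr _%:R; lia.
  rewrite natrB; last by lia.
  set x := tcoef _ _.+1; set y := tcoef _ _ => E.
  apply/eqP; rewrite -subr_eq0; apply/eqP.
  transitivity (Z *
    ((m.+1%:R - i%:R) * x - (m%:R - i%:R - (N - 1)) * y)); last by rewrite E subrr mulr0.
  by rewrite !natrD -!natr1; ring.
- by rewrite /b ltnn.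
Qed.

Lemma fixed_binsum r m gamma : reflection r gamma =1 gamma -> binsum r m gamma = 0.
Proof.
elim: m r gamma => [|m IH] r gamma fix_g.
  (* The member of index 0 is 2 gamma_1 - r gamma_0, the constant term of [hder]. *)
  rewrite -(hder_fixed0 fix_g) /binsum /hder !big_ord_recl big_ord0 /=.
  rewrite /bump /= tcoef0 bin0 bin1 mulr0 !add0r.
  have -> : tcoef r 1 = - r by rewrite /tcoef big_ord1 divr1 sub0r.
  ring.
have := IH _ _ (fixed_hder fix_g); rewrite binsum_hder => /eqP.
by rewrite mulf_eq0 pnatr_eq0 /= => /eqP.
Qed.

Lemma fixed_condB (s : nat) gamma m :
  reflection s%:R gamma =1 gamma -> (0 < m)%N -> condB s gamma m.
Proof.
case: m => // m /(fixed_binsum m) E _; rewrite /condB.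
transitivity ((-1) ^+ m.+1 * binsum s%:R m gamma); last by rewrite E mulr0.
rewrite /binsum mulr_sumr; apply: eq_bigr => i _.
have le : (i <= m.+1)%N by rewrite -ltnS.
have -> : (2 * m.+1 + s - 2 = 2 * m + s)%N by lia.
have -> : (m.+1 + i - 1 = m + i)%N by lia.
rewrite -natrM -natrD tcoef_bin !mulrA; congr (_ * _ * _ * _).
by rewrite -exprD -[RHS]signr_odd oddD oddB // addKb signr_odd.
Qed.

Lemma natr_bin a k : 'C(a + k, k)%:R = (a + k)`!%:R / (a`!%:R * k`!%:R) :> K.
Proof.
have a0 := natr_fact_neq0 K a; have k0 := natr_fact_neq0 K k.
apply: (canRL (mulfK _)); first by rewrite mulf_neq0.
rewrite -!natrM; congr _%:R.
by have := @bin_fact (a + k) k; rewrite addnK leq_addl mulnC => <- //; lia.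
Qed.

Lemma fixed_condC (s : nat) gamma m : reflection (- s%:R) gamma =1 gamma ->
  (0 < m)%N -> (m <= uphalf s)%N -> condC s gamma m.
Proof.
case: m => // m /(fixed_binsum m) E _ le_ms; rewrite /condC.
(* The bound on m says exactly that 2m - s is a negative integer -(p+1), so [tcoef_negbin] gives
   ordinary binomials; the scalar below comes from comparing factorials. *)
have [p sE] : exists p, s = (p + 2 * m + 1)%N.
  by exists (s - (2 * m + 1))%N; move: le_ms; rewrite uphalf_half; lia.
have s0 := natr_fact_neq0 K (1 + s); have p0 := natr_fact_neq0 K p.
have m0 := natr_fact_neq0 K m.+1.
transitivity (p`!%:R * m.+1`!%:R * m.+1`!%:R / (1 + s)`!%:R * binsum (- s%:R) m gamma);
  last by rewrite E mulr0.
rewrite /binsum mulr_sumr; apply: eq_bigr => i _.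
have le : (i <= m.+1)%N by rewrite -ltnS.
have -> : (m.+1 + i - 1 = m + i)%N by lia.
rewrite [RHS]mulrA; congr (_ * _).
have -> : 2 * m%:R - s%:R = - p.+1%:R :> K by rewrite sE natrD natrD natrM -natr1; ring.
rewrite tcoef_negbin natr_bin.
have -> : 'C(m.+1, i)%:R = m.+1`!%:R / ((m.+1 - i)`!%:R * i`!%:R) :> K.
  by have := natr_bin (m.+1 - i) i; rewrite (subnK le).
have -> : 'C(1 + s, m.+1 + i)%:R
    = (1 + s)`!%:R / ((p + (m.+1 - i))`!%:R * (m.+1 + i)`!%:R) :> K.
  have -> : (1 + s = p + (m.+1 - i) + (m.+1 + i))%N by lia.
  exact: natr_bin.
rewrite natr_bin.
have i0 := natr_fact_neq0 K i.
have k0 := natr_fact_neq0 K (m.+1 - i).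
have l0 := natr_fact_neq0 K (p + (m.+1 - i)).
have q0 := natr_fact_neq0 K (m.+1 + i).
move: (i`!%:R) i0 (_`!%:R) k0 (_`!%:R) l0 (_`!%:R) q0 => x1 i0 x2 k0 x3 l0 x4 q0.
move: (p`!%:R) p0 (m.+1`!%:R) m0 ((1 + s)`!%:R) s0 => y1 p0 y2 m0 y3 s0.
by field; rewrite ?i0 ?k0 ?l0 ?q0 ?p0 ?m0 ?s0.
Qed.

End Conditions.

(** * The equivalence, with a functional of top index n for each odd n *)

Theorem theorem1p1 (K : numFieldType) (d : nat) (a : int) (gamma : nat -> K) :
  let r : int := - (a + d%:Z) in
  functional_eq d a gamma <->
  [/\ (~~ odd `|r|%N -> forall m : nat, (1 <= m)%N -> condA r gamma m),
      (0 < r -> odd `|r|%N -> forall m : nat, (1 <= m)%N -> condB `|r|%N gamma m),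
      (r < 0 -> forall m : nat, (1 <= m)%N -> (m <= uphalf `|r|%N)%N ->
         condC `|r|%N gamma m)
    & (r < 0 -> odd `|r|%N -> forall m : nat, (1 <= m)%N -> condD r gamma m)].
Proof.
move=> r; rewrite functional_eq_reflection -/r.
have r_pos : 0 < r -> r%:~R = `|r|%N%:R :> K.
  by move=> r0; rewrite pmulrn gez0_abs // ltW.
have r_neg : r < 0 -> r%:~R = - `|r|%N%:R :> K.
  by move=> r0; rewrite pmulrn ltz0_abs // mulrNz opprK.
split=> [fix_g | [cA cB cC cD]].
  split=> [even_r m|r0 odd_r m|r0 m|r0 odd_r m].
  - exact: fixed_condA.
  - by apply: fixed_condB; rewrite -r_pos.
  - by apply: fixed_condC; rewrite -r_neg.
  - exact: fixed_condD.
have bin_neq0 (x y : nat) : (y <= x)%N -> 'C(x, y)%:R != 0 :> K.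
  by move=> le; rewrite pnatr_eq0 -lt0n bin_gt0.
apply: fixed_of_functionals => n odd_n.
have [k nE] : exists k, n = (2 * k).+1 by exists n./2; lia.
(* Condition (C) at k+1 has top index 2k+1 = n; its range covers exactly the odd n with n <= -r. *)
have useC : r < 0 -> (k.+1 <= uphalf `|r|%N)%N ->
  exists m (c : nat -> K) (x : nat -> int),
    [/\ c m != 0, x m = n%:Z, forall i, (i < m)%N -> x i < n%:Z,
        forall f, reflection r%:~R f =1 f -> \sum_(i < m.+1) c i * gamz f (x i) = 0
      & \sum_(i < m.+1) c i * gamz gamma (x i) = 0].
  move=> r0 le_k; exists k.+1.
  exists (fun i => 'C(k.+1, i)%:R * ('C(1 + `|r|%N, k.+1 + i)%:R)^-1).
  exists (fun i => (k.+1 + i - 1)%N%:Z); split; [|lia|lia| |].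
  - rewrite mulf_neq0 ?invr_eq0 ?bin_neq0 //.
    by move: le_k; rewrite uphalf_half; lia.
  - by move=> f; rewrite r_neg // => /fixed_condC; apply.
  - exact: cC.
have [odd_r|even_r] := boolP (odd `|r|%N); last first.
  have [le_rn|lt_nr] := lerP (1 - r) n%:Z; last first.
    by apply: useC; rewrite ?uphalf_half; lia.
  (* Condition (A) at m+1 has top index 2m+1-r. *)
  have [m mE] : exists m : nat, 2 * m%:Z = n%:Z - 1 + r.
    by exists `|(n%:Z - 1 + r) %/ 2|%Z%N; lia.
  exists m, (fun i => (-1) ^+ i * 'C(m, i)%:R), (fun i => m.+1%:Z - r + i%:Z).
  split; [|lia|lia| |].
  - by rewrite mulf_neq0 ?signr_eq0 ?bin_neq0.
  - by move=> f fix_f; apply: (@fixed_condA _ r f m.+1).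
  - exact: (cA even_r m.+1).
have [r0|r0] : 0 < r \/ r < 0 by lia.
  exists k.+1, (fun i => (-1) ^+ i * 'C(2 * k.+1 + `|r|%N - 2, k.+1 - i)%:R
    * 'C(k.+1 + i, i)%:R), (fun i => (k.+1 + i - 1)%N%:Z).
  split; [|lia|lia| |].
  - by rewrite !mulf_neq0 ?signr_eq0 ?bin_neq0 ?leq_addl // subnn.
  - by move=> f; rewrite r_pos // => /fixed_condB; apply.
  - exact: cB.
have [le_nr|lt_rn] := leqP n `|r|%N.
  by apply: useC => //; rewrite uphalf_half; lia.
(* Condition (D) at m+1 has top index 2(m+1)-r. As n and r are both odd and n > -r, n+r is even and
   at least 2. *)
have [m mE] : exists m : nat, n%:Z = 2 * m.+1%:Z - r.
  by exists (`|(n%:Z + r) %/ 2|%Z%N).-1; lia.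
exists m.+1, (fun i => (-1) ^+ i * 'C(m.+1, i)%:R * ((m.+1 + i)%:R / m.+1%:R)).
exists (fun i => m.+1%:Z - r + i%:Z); split; [|lia|lia| |].
- by rewrite !mulf_neq0 ?signr_eq0 ?bin_neq0 ?invr_eq0 ?pnatr_eq0.
- by move=> f fix_f; apply: (@fixed_condD _ r f m.+1).
- exact: (cD r0 odd_r m.+1).
Qed.
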